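(* For any $\beta\in\mathbb{C}^n$ and any homogeneous polynomial $P(z)\in\mathbb{C}[z]$ of degree $d\ge2$, set $P_\beta(z):=\beta_D^{d-2}P(z)$. Then $$\mathrm{Hes}\,P_\beta=(d-2)!\,(\mathrm{Hes}\,P)(\beta).$$ In particular, $P(z)$ is HN if and only if, for any $\beta\in\mathbb{C}^n$, $P_\beta(z)$ is HN.
   Context: $z=(z_1,\dots,z_n)$, $D_i=\partial/\partial z_i$. For $\beta=(\beta_1,\dots,\beta_n)\in\mathbb{C}^n$, $\beta_D:=\sum_{i=1}^n\beta_iD_i$. $\mathrm{Hes}\,P=(D_iD_jP)_{n\times n}$ is the Hessian matrix, and $(\mathrm{Hes}\,P)(\beta)$ is its value at $z=\beta$. A polynomial is HN (Hessian nilpotent) if its Hessian matrix is nilpotent. *)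

(* Defs.v *)
From HB Require Import structures.
From mathcomp Require Import all_boot all_order all_algebra.
From mathcomp Require Import reals.
From mathcomp Require Import complex mpoly.

Set Implicit Arguments.
Unset Strict Implicit.
Unset Printing Implicit Defensive.

Import GRing.Theory.
Local Open Scope ring_scope.

(* beta_D = \sum_i beta_i D_i *)
Definition dir_deriv (K : comNzRingType) (n : nat) (beta : 'I_n -> K)
    (P : {mpoly K[n]}) : {mpoly K[n]} :=
  \sum_(i < n) beta i *: P^`M(i).

Definition hessian (K : comNzRingType) (n : nat) (P : {mpoly K[n]}) :
    'M[{mpoly K[n]}]_n :=
  \matrix_(i < n, j < n) (P^`M(j))^`M(i).

Definition hessian_at (K : comNzRingType) (n : nat) (P : {mpoly K[n]})
    (beta : 'I_n -> K) : 'M[K]_n :=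
  map_mx (meval beta) (hessian P).

(* 'M_n is a ring for every n, also n = 0, so ^+ is the matrix power. *)
Definition nilpotent_mx (A : pzRingType) (n : nat) (M : 'M[A]_n) : Prop :=
  exists k : nat, M ^+ k = 0.

Definition HN (K : comNzRingType) (n : nat) (P : {mpoly K[n]}) : Prop :=
  nilpotent_mx (hessian P).

(* A matrix over K read as a matrix of constant polynomials. *)
Definition const_poly_mx (K : comNzRingType) (n : nat) (M : 'M[K]_n) :
    'M[{mpoly K[n]}]_n :=
  map_mx (@mpolyC n K) M.

(* P_beta = beta_D^(d-2) P; d is a parameter, not read off from P, so that the
   zero polynomial may be taken homogeneous of any degree. Only meant for
   2 <= d, as d - 2 is truncated. *)
Definition P_dir (K : comNzRingType) (n d : nat) (P : {mpoly K[n]})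
    (beta : 'I_n -> K) : {mpoly K[n]} :=
  iter (d - 2) (dir_deriv beta) P.

(* Main.v *)
Require Import Defs.
From HB Require Import structures.
From mathcomp Require Import all_boot all_order all_algebra.
From mathcomp Require Import reals.
From mathcomp Require Import complex mpoly.

Set Implicit Arguments.
Unset Strict Implicit.
Unset Printing Implicit Defensive.

Import GRing.Theory.
Local Open Scope ring_scope.

(* Partial derivatives commute with beta_D, so the entries of Hes P_beta are
   beta_D^(d-2) applied to forms of degree d-2; by iterating Euler's identity,
   beta_D^m Q = m! Q(beta) for every form Q of degree m. For the equivalence,
   nilpotency of an n x n matrix over a field is the single polynomial
   condition A^n = 0, and a polynomial over an infinite field that vanishes at
   every point is zero. *)

Section DirectionalDerivative.
Variables (K : comNzRingType) (n : nat).
Implicit Types (P : {mpoly K[n]}) (beta : 'I_n -> K).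

Lemma mderiv_dir_deriv beta i P :
  (dir_deriv beta P)^`M(i) = dir_deriv beta P^`M(i).
Proof.
rewrite /dir_deriv raddf_sum /=; apply: eq_bigr => j _.
by rewrite mderivZ mderiv_comm.
Qed.

Lemma mderiv_iter_dir_deriv beta k i P :
  (iter k (dir_deriv beta) P)^`M(i) = iter k (dir_deriv beta) P^`M(i).
Proof. by elim: k => //= k IHk; rewrite mderiv_dir_deriv IHk. Qed.

(** The truncation in [d.-1] is harmless: for [d = 0] the derivative is zero, which is homogeneous
    of every degree. *)
Lemma mderiv_homog d i P : P \is d.-homog -> P^`M(i) \is d.-1.-homog.
Proof.
move=> homP; apply/dhomogP => m; rewrite mcoeff_msupp mcoeff_mderiv => nz.
have /(dhomog_mf homP) : (m + U_(i))%MM \in msupp P.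
  by rewrite mcoeff_msupp; apply: contraNneq nz => ->; rewrite mul0rn.
by move=> /= <-; rewrite mdegD mdeg1 addn1.
Qed.

Lemma dir_deriv_homog d beta P :
  P \is d.-homog -> dir_deriv beta P \is d.-1.-homog.
Proof.
by move=> homP; apply: rpred_sum => i _; apply/rpredZ/mderiv_homog.
Qed.

(** Monomial by monomial: ['X_i] times the [i]-th derivative multiplies ['X_[m]] by [m i], and these
    exponents sum to [d]. *)
Lemma euler_homog d P :
  P \is d.-homog -> \sum_(i < n) 'X_i * P^`M(i) = d%:R *: P.
Proof.
move=> homP; rewrite [in RHS](mpolyE P) scaler_sumr.
transitivity (\sum_(i < n) \sum_(m <- msupp P)
    'X_i * (P@_m *: 'X_[m] : {mpoly K[n]})^`M(i)).
  by apply: eq_bigr => i _; rewrite -mulr_sumr -raddf_sum -mpolyE.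
rewrite exchange_big /=; apply: eq_big_seq => m /(dhomog_mf homP) <-.
transitivity (\sum_(i < n) ((m i)%:R * P@_m) *: 'X_[m] : {mpoly K[n]}).
  apply: eq_bigr => i _; rewrite mderivZ mderivX -!scalerAr scalerA mulrC.
  (* If [m i = 0], the truncated [m - U_(i)] cannot be undone by adding [U_(i)], but the coefficient
     vanishes. *)
  have [->|mi_neq0] := eqVneq (m i) 0%N; first by rewrite mul0r !scale0r.
  congr (_ *: _); rewrite -mpolyXD addmC submK //.
  by rewrite lep1mP.
by rewrite -scaler_suml -mulr_suml /= mdegE natr_sum scalerA.
Qed.

(** Euler's identity evaluated at [beta], where each ['X_i] becomes [beta i]. *)
Lemma meval_dir_deriv_homog d beta P :
  P \is d.-homog -> (dir_deriv beta P).@[beta] = d%:R * P.@[beta].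
Proof.
move=> /euler_homog/(congr1 (meval beta)); rewrite mevalZ => <-.
rewrite !raddf_sum /=; apply: eq_bigr => i _.
by rewrite mevalZ mevalM mevalXU.
Qed.

Lemma homog0_mpolyC P beta : P \is 0.-homog -> P = P.@[beta]%:MP.
Proof.
move=> homP; have Pc : P = (P@_0)%:MP.
  apply/mpolyP => m; rewrite mcoeffC; have [->|m_neq0] := eqVneq 0%MM m.
    by rewrite mulr1.
  rewrite mulr0; apply: dhomog_nemf_coeff homP _.
  by rewrite mdeg_eq0 eq_sym.
by rewrite {2}Pc mevalC -Pc.
Qed.

Lemma iter_dir_deriv_homog m beta P :
  P \is m.-homog -> iter m (dir_deriv beta) P = (m`!%:R * P.@[beta])%:MP.
Proof.
elim: m P => [|m IHm] P homP; first by rewrite mul1r /= -homog0_mpolyC.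
rewrite iterSr IHm; last exact: dir_deriv_homog homP.
by rewrite (meval_dir_deriv_homog _ homP) factS natrM mulrA [_ * m.+1%:R]mulrC.
Qed.

Lemma hessian_P_dir d P beta : P \is d.-homog ->
  hessian (P_dir d P beta)
  = const_poly_mx ((d - 2)`!%:R *: hessian_at P beta).
Proof.
move=> homP; apply/matrixP => i j; rewrite !mxE !mderiv_iter_dir_deriv.
by rewrite iter_dir_deriv_homog // subn2; do 2!apply: mderiv_homog.
Qed.

End DirectionalDerivative.

Section MapNilpotent.
Variables (A B : pzRingType) (f : {rmorphism A -> B}) (n : nat).

Lemma map_mx_exp (M : 'M[A]_n) k : map_mx f (M ^+ k) = map_mx f M ^+ k.
Proof.
by elim: k => [|k IHk]; rewrite ?map_mx1 // !exprS map_mxM IHk.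
Qed.

Lemma nilpotent_map_mx (M : 'M[A]_n) :
  nilpotent_mx M -> nilpotent_mx (map_mx f M).
Proof. by case=> k Mk0; exists k; rewrite -map_mx_exp Mk0 map_mx0. Qed.

Lemma nilpotent_map_mxE (M : 'M[A]_n) :
  injective f -> nilpotent_mx (map_mx f M) <-> nilpotent_mx M.
Proof.
move=> f_inj; split; last exact: nilpotent_map_mx.
case=> k; rewrite -map_mx_exp => /matrixP Mk0; exists k; apply/matrixP => i j.
by apply: f_inj; have := Mk0 i j; rewrite !mxE rmorph0.
Qed.

End MapNilpotent.

Lemma nilpotent_mx_scale (K : fieldType) n (c : K) (M : 'M[K]_n) :
  c != 0 -> nilpotent_mx (c *: M) <-> nilpotent_mx M.
Proof.
have scaleX (a : K) (A : 'M[K]_n) k : (a *: A) ^+ k = a ^+ k *: A ^+ k.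
  elim: k => [|k IHk]; first by rewrite !expr0 scale1r.
  (* The ring product is exposed as [*m] so that scalars can be moved out of it. *)
  by rewrite !exprS IHk -[LHS]/(_ *m _) -scalemxAl -scalemxAr scalerA.
move=> c_neq0; split=> -[k Mk0]; exists k.
  apply: (scalerI (expf_neq0 k c_neq0)).
  by rewrite -scaleX Mk0 scaler0.
by rewrite scaleX Mk0 scaler0.
Qed.

(** The minimal polynomial divides a power of ['X], so it is associated to some ['X^j]; it also
    divides the characteristic polynomial, so [j <= n]. *)
Lemma nilpotent_mx_expr_dim (K : fieldType) n (M : 'M[K]_n) :
  nilpotent_mx M -> M ^+ n = 0.
Proof.
case: n M => [|n] M [k Mk0]; first exact: flatmx0.
(* ['X] is written ['X - 0%:P] to fit the description of the divisors of a power of a linear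
   factor. *)
have /dvdp_exp_XsubCP[j _ minMj] : mxminpoly M %| ('X - 0%:P) ^+ k.
  by apply: mxminpoly_min; rewrite subr0 rmorphXn /= horner_mx_X.
apply/eqP; rewrite -[M]horner_mx_X -rmorphXn /= -dvd_mxminpoly.
rewrite (eqp_dvdl _ minMj) subr0 dvdp_exp2l //.
rewrite subr0 in minMj; have := eqp_size minMj.
rewrite size_mxminpoly size_polyXn => -[<-].
have := dvdp_leq _ (mxminpoly_dvd_char M).
rewrite size_char_poly size_mxminpoly ltnS; apply.
exact/monic_neq0/char_poly_monic.
Qed.

Section Vanishing.
Variable K : numDomainType.

(** In characteristic zero the integers below [size p] are distinct roots, one more than the degree
    of a nonzero [p] allows. *)
Lemma poly_horner_eq0 (p : {poly K}) : (forall x, p.[x] = 0) -> p = 0.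
Proof.
move=> p_eq0; apply: contraTeq isT => p_neq0.
have := max_poly_roots p_neq0 (rs := [seq i%:R | i <- iota 0 (size p)]).
rewrite size_map size_iota ltnn; apply.
  by apply/allP => x _; rewrite /root p_eq0.
rewrite map_inj_uniq ?iota_uniq //.
by apply: Num.Theory.mulrIn; rewrite oner_eq0.
Qed.

(** [muni] singles out the last variable, so the coefficients are evaluated at the first [n]
    coordinates of [v]. *)
Lemma meval_muni n (p : {mpoly K[n.+1]}) (v : 'I_n.+1 -> K) :
  (map_poly (meval (v \o widen_ord (leqnSn n))) (muni p)).[v ord_max] = p.@[v].
Proof.
rewrite muniE raddf_sum /= horner_sum mevalE; apply: eq_bigr => m _.
rewrite -mul_polyC rmorphM /= map_polyC map_polyXn hornerCM hornerXn /=.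
rewrite mevalZ mevalX big_ord_recr /= mulrA; congr (_ * _ * _).
by apply: eq_bigr => i _; rewrite mnmE.
Qed.

Lemma muni_eq0 n (p : {mpoly K[n.+1]}) : muni p = 0 -> p = 0.
Proof.
move=> p_eq0; apply/mpolyP => m; rewrite mcoeff0.
(* A monomial is determined by its last exponent and its restriction [wm m] to the other variables,
   so each coefficient of [p] can be read off [muni p]. *)
pose wm (m : 'X_{1..n.+1}) : 'X_{1..n} :=
  [multinom m (widen_ord (leqnSn n) i) | i < n].
have := congr1 (fun q : {poly {mpoly K[n]}} => (q`_(m ord_max))@_(wm m)) p_eq0.
rewrite coef0 mcoeff0 => <-; rewrite muniE coef_sum raddf_sum {1}(mpolyE p).
rewrite raddf_sum; apply: eq_bigr => m' _ /=.
rewrite coefZ coefXn mcoeffZ mcoeffX -/(wm m').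
have [->|m'_neq] := eqVneq m' m.
  by rewrite !eqxx !mulr1 mcoeffZ mcoeffX eqxx mulr1.
rewrite mulr0; have [max_eq|_] := eqVneq (m ord_max) (m' ord_max).
  rewrite mulr1 mcoeffZ mcoeffX; have [wm_eq|_] := eqVneq (wm m') (wm m).
    case/eqP: m'_neq; apply/mnmP => i.
    have [j ->|->] := unliftP ord_max i; last by rewrite max_eq.
    have -> : lift ord_max j = widen_ord (leqnSn n) j.
      by apply: val_inj; rewrite /= /bump leqNgt ltn_ord.
    by have /mnmP/(_ j) := wm_eq; rewrite !mnmE.
  by rewrite mulr0.
by rewrite mulr0 mcoeff0.
Qed.

(** Induction on the number of variables: with the first [n] fixed, the polynomial in the last one
    vanishes everywhere, so each of its coefficients vanishes at every point. *)
Lemma mpoly_meval_eq0 n (p : {mpoly K[n]}) :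
  (forall v, p.@[v] = 0) -> p = 0.
Proof.
elim: n p => [|n IHn] p p_eq0.
  by rewrite (homog0_mpolyC (fun _ => 0) (nvar0_homog mdeg p)) p_eq0.
apply/muni_eq0/polyP => k; rewrite coef0; apply: IHn => v.
(* The point [v] extended by [x] as last coordinate. *)
pose w x (i : 'I_n.+1) := if unlift ord_max i is Some j then v j else x.
have v_w x : v =1 w x \o widen_ord (leqnSn n).
  move=> j; rewrite /w /=; have -> : widen_ord (leqnSn n) j = lift ord_max j.
    by apply: val_inj; rewrite /= /bump leqNgt ltn_ord.
  by rewrite liftK.
rewrite -(coef_map (meval v)) (_ : map_poly _ _ = 0) ?coef0 //.
apply: poly_horner_eq0 => x; rewrite -(p_eq0 (w x)) -meval_muni.
rewrite {2}/w unlift_none; congr _.[_].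
by apply: eq_map_poly => q; apply: meval_eq.
Qed.

End Vanishing.

Lemma nilpotent_hessianP (K : numFieldType) n (P : {mpoly K[n]}) :
  HN P <-> forall beta, nilpotent_mx (hessian_at P beta).
Proof.
split=> [HN_P beta|nil_P]; first exact: (nilpotent_map_mx (meval beta)) HN_P.
(* The exponents given by [nil_P] vary with [beta]; the dimension [n] serves for all of them at
   once. *)
exists n; apply/matrixP => i j; rewrite mxE.
apply: mpoly_meval_eq0 => beta.
have /matrixP/(_ i j) := nilpotent_mx_expr_dim (nil_P beta).
by rewrite -map_mx_exp !mxE.
Qed.

Lemma HN_P_dir (K : numFieldType) n d (P : {mpoly K[n]}) beta :
  P \is d.-homog ->
  HN (P_dir d P beta) <-> nilpotent_mx (hessian_at P beta).
Proof.
move=> homP; rewrite /HN hessian_P_dir //.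
apply: iff_trans (nilpotent_map_mxE _ _) _.
  (* Evaluation at [beta] is a left inverse of the embedding of constants. *)
  by move=> a b /(congr1 (meval beta)); rewrite !mevalC.
apply: nilpotent_mx_scale.
by rewrite Num.Theory.pnatr_eq0 -lt0n fact_gt0.
Qed.

Theorem theorem6p1 (R : realType) (n d : nat) (P : {mpoly R[i][n]})
    (d_ge2 : (2 <= d)%N) (P_homog : P \is d.-homog) :
  (forall beta : 'I_n -> R[i],
     hessian (P_dir d P beta)
     = const_poly_mx (((d - 2)`!)%:R *: hessian_at P beta)) /\
  (HN P <-> forall beta : 'I_n -> R[i], HN (P_dir d P beta)).
Proof.
split=> [beta|]; first exact: hessian_P_dir.
apply: (iff_trans (nilpotent_hessianP P)).
by split=> nil_P beta; apply/(HN_P_dir beta P_homog).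
Qed.
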